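(* Let $q\in(0,1)$. Then $$P_n^q(S_n(\tau))>(1-q)^n\quad\text{for all }\tau\in S_3\setminus\{123\}\text{ and all } n\ge3.$$
   Context: $S_n$ is the set of permutations $\sigma=\sigma_1\cdots\sigma_n$ of $[n]=\{1,\dots,n\}$, where $\sigma_i=\sigma(i)$. For $\tau\in S_m$ with $2\le m\le n$, $\sigma\in S_n$ contains $\tau$ as a pattern if there are indices $1\le i_1<\cdots<i_m\le n$ such that for all $1\le j,k\le m$, $\sigma_{i_j}<\sigma_{i_k}$ if and only if $\tau_j<\tau_k$; otherwise $\sigma$ avoids $\tau$. $S_n(\tau)$ is the set of $\sigma\in S_n$ avoiding $\tau$. For $q>0$, the Mallows distribution with parameter $q$ is the probability measure on $S_n$ given by $P_n^q(\sigma)=q^{\mathrm{inv}(\sigma)}/Z_n(q)$, where $\mathrm{inv}(\sigma)$ is the number of inversions of $\sigma$, i.e. pairs $i<j$ with $\sigma_i>\sigma_j$, and $Z_n(q)=\sum_{\sigma\in S_n}q^{\mathrm{inv}(\sigma)}$, which for $q\neq 1$ equals $\prod_{k=1}^n\frac{1-q^k}{1-q}$. *)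

(* Defs.v *)
(* The set [n] = {1, ..., n} is represented by 'I_n = {0, ..., n-1}; pattern
   containment and inversions depend only on the order.  In particular the
   pattern 12...m is the identity 1%g of 'S_m. *)
From mathcomp Require Import all_boot all_order all_algebra all_fingroup.

Set Implicit Arguments.
Unset Strict Implicit.
Unset Printing Implicit Defensive.

Import Order.TTheory GRing.Theory Num.Theory.
Local Open Scope ring_scope.

Definition contains_pattern (m n : nat) (tau : 'S_m) (sigma : 'S_n) : bool :=
  [exists i : {ffun 'I_m -> 'I_n},
     [forall j : 'I_m, forall k : 'I_m, (j < k)%N ==> (i j < i k)%N] &&
     [forall j : 'I_m, forall k : 'I_m,
        (sigma (i j) < sigma (i k))%N == (tau j < tau k)%N]].

Definition avoiders (m n : nat) (tau : 'S_m) : {set 'S_n} :=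
  [set sigma : 'S_n | ~~ contains_pattern tau sigma].

Definition inv_num (n : nat) (sigma : 'S_n) : nat :=
  #|[set p : 'I_n * 'I_n | (p.1 < p.2)%N && (sigma p.2 < sigma p.1)%N]|.

Definition mallows_Z (R : realFieldType) (n : nat) (q : R) : R :=
  \sum_(sigma : 'S_n) q ^+ inv_num sigma.

Definition mallows (R : realFieldType) (n : nat) (q : R) (sigma : 'S_n) : R :=
  q ^+ inv_num sigma / mallows_Z n q.

Definition mallows_prob (R : realFieldType) (n : nat) (q : R)
    (A : {set 'S_n}) : R :=
  \sum_(sigma in A) mallows q sigma.

Lemma mallows_Z_gt0 (R : realFieldType) (n : nat) (q : R) :
  0 < q -> 0 < mallows_Z n q.
Proof.
move=> q0; rewrite /mallows_Z (bigD1 1%g) //= ltr_pwDl ?exprn_gt0 //.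
by apply: sumr_ge0 => s _; rewrite exprn_ge0 // ltW.
Qed.

Lemma mallows_ge0 (R : realFieldType) (n : nat) (q : R) (sigma : 'S_n) :
  0 < q -> 0 <= mallows q sigma.
Proof.
by move=> q0; rewrite divr_ge0 ?exprn_ge0 // ltW // mallows_Z_gt0.
Qed.

Lemma mallows_probT (R : realFieldType) (n : nat) (q : R) :
  0 < q -> mallows_prob q [set: 'S_n] = 1.
Proof.
move=> q0; rewrite /mallows_prob.
under eq_bigl do rewrite inE.
by rewrite -mulr_suml divff // gt_eqF // mallows_Z_gt0.
Qed.

(* Main.v *)
(* The identity has no inversions and, since tau <> 123, it avoids tau; hence
   the probability is at least 1 / Z_n(q).  The inversion (Lehmer) code embeds
   S_n into the functions [n] -> {0, ..., n-1} and turns inv into the sum of the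
   values, so Z_n(q) <= (1 + q + ... + q^(n-1))^n = ((1 - q^n) / (1 - q))^n,
   which is smaller than (1 - q)^(-n). *)
Require Import Defs.
From mathcomp Require Import all_boot all_order all_algebra all_fingroup.

Set Implicit Arguments.
Unset Strict Implicit.
Unset Printing Implicit Defensive.

Import Order.TTheory GRing.Theory Num.Theory.
Local Open Scope ring_scope.

Definition lehmer_set (n : nat) (s : 'S_n) (i : 'I_n) : {set 'I_n} :=
  [set j : 'I_n | (i < j)%N && (s j < s i)%N].

Lemma inv_num_sum (n : nat) (s : 'S_n) :
  inv_num s = (\sum_(i < n) #|lehmer_set s i|)%N.
Proof.
rewrite /inv_num -sum1dep_card.
under [RHS]eq_bigr => i _ do rewrite /lehmer_set -sum1dep_card.
by rewrite pair_big_dep.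
Qed.

Lemma ltn_card_lehmer_set (n : nat) (s : 'S_n) (i : 'I_n) :
  (#|lehmer_set s i| < n)%N.
Proof.
rewrite -[X in (_ < X)%N]card_ord -cardsT; apply: proper_card.
rewrite properT; apply/eqP => /setP/(_ i).
by rewrite !inE ltnn.
Qed.

Definition lehmer (n : nat) (s : 'S_n) : {ffun 'I_n -> 'I_n} :=
  [ffun i => Ordinal (ltn_card_lehmer_set s i)].

(* The first condition depends only on the values of s before position i, so
   this form can be compared between permutations with a common prefix. *)
Lemma lehmer_values (n : nat) (s : 'S_n) (i : 'I_n) :
  lehmer s i
  = #|[set v : 'I_n | ~~ ((s^-1)%g v < i)%N && (v < s i)%N]| :> nat.
Proof.
rewrite ffunE /= -(card_imset _ (@perm_inj _ s)).
apply: eq_card => v; rewrite [in RHS]inE.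
rewrite -[v in LHS](permKV s) mem_imset; last exact: perm_inj.
(* The two sets could differ only at position [i], whose value [s i] is not below itself. *)
rewrite inE permKV -leqNgt [X in _ = X && _]leq_eqVlt.
case: eqP => //= /ord_inj eq_i.
by rewrite eq_i permKV !ltnn.
Qed.

(** At the first position where two permutations differ, the values already taken coincide, so the
    larger value there has strictly more free values below it, hence a larger code. *)
Lemma lehmer_inj (n : nat) : injective (@lehmer n).
Proof.
have lt_absurd (s t : 'S_n) (i : 'I_n) : lehmer s = lehmer t ->
    (forall j : 'I_n, (j < i)%N -> s j = t j) -> ~~ (s i < t i)%N.
  move=> eq_st agree; apply/negP => lt_st.
  have used v : ((s^-1)%g v < i)%N = ((t^-1)%g v < i)%N.
    have tr : forall s t : 'S_n, (forall j : 'I_n, (j < i)%N -> s j = t j) ->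
        ((s^-1)%g v < i)%N -> ((t^-1)%g v < i)%N.
      by move=> a b ab lt_v; rewrite -[v in X in (X < _)%N](permKV a) ab // permK.
    apply/idP/idP; apply: tr => // j lt_j; exact/esym/agree.
  have := lehmer_values s i; rewrite eq_st lehmer_values => /eqP.
  apply/negP; rewrite neq_ltn; apply/orP; right; apply: proper_card.
  apply/properP; split.
    apply/subsetP => v; rewrite !inE used => /andP[-> /=] lt_v.
    exact: ltn_trans lt_v lt_st.
  (* The value [s i] makes the inclusion strict: it is free and below [t i], but not below
     itself. *)
  by exists (s i); rewrite !inE -?used permK !ltnn.
move=> s t eq_st; apply/permP => i.
have [m] := ubnP (val i); elim: m i => // m IH i /ltnSE le_im.
have agree (j : 'I_n) : (j < i)%N -> s j = t j.
  by move=> lt_ji; apply: IH; apply: leq_trans lt_ji le_im.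
apply/val_inj/eqP; rewrite eqn_leq leqNgt [X in _ && X]leqNgt.
by rewrite (lt_absurd s t) // (lt_absurd t s) // => j /agree.
Qed.

Lemma inv_num1 (n : nat) : inv_num (1%g : 'S_n) = 0%N.
Proof.
apply/eqP; rewrite cards_eq0; apply/eqP/setP => p; rewrite !inE !perm1.
by case: ltngtP.
Qed.

(** Without inversions every Lehmer set is empty, as for the identity, and the code determines the
    permutation. *)
Lemma increasing_perm_eq1 (n : nat) (s : 'S_n) :
  (forall i j : 'I_n, (i < j)%N -> (s i < s j)%N) -> s = 1%g.
Proof.
move=> incr; apply: lehmer_inj; apply/ffunP => i; apply: val_inj.
rewrite !ffunE /=; apply: eq_card => j; rewrite !inE !perm1.
by case: ltngtP => // /incr; case: ltngtP.
Qed.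

(** Any pattern occurring in the identity is increasing, hence itself an identity. *)
Lemma avoiders1 (m n : nat) (tau : 'S_m) :
  tau <> 1%g -> (1%g : 'S_n) \in avoiders n tau.
Proof.
move=> tau_neq1; rewrite inE; apply/negP => /existsP[i /andP[/forallP incr
  /forallP same]]; apply: tau_neq1; apply: increasing_perm_eq1 => j k lt_jk.
have /forallP/(_ k)/eqP <- := same j.
by rewrite !perm1; have /forallP/(_ k)/implyP := incr j; apply.
Qed.

Lemma mallows_Z_le (R : realFieldType) (n : nat) (q : R) :
  0 < q -> mallows_Z n q <= (\sum_(k < n) q ^+ k) ^+ n.
Proof.
move=> q_gt0.
have -> : (\sum_(k < n) q ^+ k) ^+ n
    = \sum_(f : {ffun 'I_n -> 'I_n}) \prod_(i < n) q ^+ f i.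
  by rewrite -[in LHS](card_ord n) -prodr_const bigA_distr_bigA card_ord.
have -> : mallows_Z n q
    = \sum_(f in @lehmer n @: [set: 'S_n]) \prod_(i < n) q ^+ f i.
  rewrite big_imset /=; last by move=> s t _ _; apply: lehmer_inj.
  apply: eq_big => [s|s _]; first by rewrite inE.
  by rewrite inv_num_sum -prodrXr; apply: eq_bigr => i _; rewrite ffunE.
(* Functions that are not codes only add nonnegative terms. *)
rewrite [leRHS](bigID (mem (@lehmer n @: [set: 'S_n]))) /= lerDl.
by apply: sumr_ge0 => f _; apply: prodr_ge0 => i _; rewrite exprn_ge0 // ltW.
Qed.

Lemma mallows_Z_lt (R : realFieldType) (n : nat) (q : R) :
  0 < q -> q < 1 -> (0 < n)%N -> (1 - q) ^+ n * mallows_Z n q < 1.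
Proof.
move=> q_gt0 q_lt1 n_gt0.
have q1_gt0 : 0 < 1 - q by rewrite subr_gt0.
(* The factor [1 - q] times the geometric sum telescopes to [1 - q ^+ n]. *)
apply: le_lt_trans (_ : (1 - q ^+ n) ^+ n < 1).
  rewrite -[1 - q ^+ n]opprB subrX1 -mulNr opprB exprMn ler_pM2l ?exprn_gt0 //.
  exact: mallows_Z_le.
rewrite exprn_ilt1 ?subr_ge0 -?lt0n //.
  by rewrite exprn_ile1 // ltW.
by rewrite ltrBlDr ltrDl exprn_gt0.
Qed.

(* The pattern 123 is the identity 1%g of 'S_3. *)
Theorem proposition1 (R : realFieldType) (q : R) (q_gt0 : 0 < q) (q_lt1 : q < 1)
    (tau : 'S_3) (tau_neq123 : tau <> 1%g) (n : nat) (n_ge3 : (3 <= n)%N) :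
  (1 - q) ^+ n < mallows_prob q (avoiders n tau).
Proof.
have Z_gt0 := mallows_Z_gt0 n q_gt0.
apply: (@lt_le_trans _ _ (mallows q (1%g : 'S_n))).
  rewrite /mallows inv_num1 expr0 ltr_pdivlMr //.
  by rewrite mallows_Z_lt // (leq_trans _ n_ge3).
rewrite /mallows_prob (bigD1 1%g) ?avoiders1 //= lerDl.
by apply: sumr_ge0 => s _; apply: mallows_ge0.
Qed.
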